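(* Let $n\geq 1$, $N=n+1$, and let $B=(b_{r-s})_{r,s=0}^n$ be a real symmetric positive-definite Toeplitz matrix, with $b_{-j}=b_j$, such that $$S_k(B)=\sum_{\substack{0\leq r,s\leq n\\ |r-s|=k}}\det B^{(r,s)}\geq 0,\quad 0\leq k\leq n.$$ Let $A=(a_{r-s})_{r,s=0}^n$, with $a_{-j}=a_j$, be a real symmetric positive-definite Toeplitz matrix satisfying $(-1)^j(b_j-a_j)\geq 0$ for $0\leq j\leq n$. Put $$X=B^{-1/2}AB^{-1/2},\quad \tau=\operatorname{tr}\bigl(B^{-1}(B-A)\bigr).$$ Then $$\log\frac{\det B}{\det A}\geq \tau+\frac{\|X-I\|_{\mathrm F}^2}{2\max\{1,\|X\|_2\}}\geq \tau+\frac{\|X-I\|_{\mathrm F}^2}{2N}.$$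
   Context: Row and column indices start at $0$; $B^{(r,s)}$ is the submatrix of $B$ obtained by deleting row $r$ and column $s$. $\|\cdot\|_{\mathrm F}$ and $\|\cdot\|_2$ denote the Frobenius and spectral norms, respectively, and $I$ is the identity matrix of order $N$. *)

(* Defs.v *)
From HB Require Import structures.
From mathcomp Require Import all_boot all_order all_algebra.
From mathcomp Require Import boolp classical_sets reals exp.
Set Implicit Arguments.
Unset Strict Implicit.
Unset Printing Implicit Defensive.
Import Order.TTheory GRing.Theory Num.Theory.
Local Open Scope classical_set_scope.
Local Open Scope ring_scope.

(* The matrix (b_{r-s})_{r,s=0}^n, of order n+1; only the values of b on
   [-n, n] matter. *)
Definition toeplitz (R : realType) (n : nat) (b : int -> R) : 'M[R]_n.+1 :=
  \matrix_(r < n.+1, s < n.+1) b (r%:Z - s%:Z).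

Definition posdef (R : realType) (n : nat) (M : 'M[R]_n) : Prop :=
  M \is symmetricmx /\
  forall x : 'cV[R]_n, x != 0 -> 0 < (x^T *m M *m x) 0 0.

(* S_k(B); the matrix B^{(r,s)} is row' r (col' s B), and the summation ranges
   over both signs of r - s. *)
Definition minor_sum (R : realType) (n : nat) (B : 'M[R]_n.+1) (k : nat) : R :=
  \sum_(r < n.+1) \sum_(s < n.+1 | `|r%:Z - s%:Z|%N == k)
    \det (row' r (col' s B)).

(* The unique positive-definite square root of a positive-definite matrix;
   0 is a dummy value, used only if no such root exists. *)
Definition sqrtmx (R : realType) (n : nat) (M : 'M[R]_n) : 'M[R]_n :=
  xget 0 [set C : 'M[R]_n | posdef C /\ C *m C = M].

(* On column vectors this is the Euclidean norm. *)
Definition frobenius_norm (R : realType) (m n : nat) (M : 'M[R]_(m, n)) : R :=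
  Num.sqrt (\sum_(i < m) \sum_(j < n) M i j ^+ 2).

(* The operator norm subordinate to the Euclidean vector norms. *)
Definition spectral_norm (R : realType) (m n : nat) (M : 'M[R]_(m, n)) : R :=
  sup [set frobenius_norm (M *m x) |
        x in [set x : 'cV[R]_n | frobenius_norm x <= 1]].

(* Main.v *)
Require Import Defs.
From HB Require Import structures.
From mathcomp Require Import all_boot all_order all_algebra.
From mathcomp Require Import complex.
From mathcomp Require Import boolp classical_sets reals exp.
From mathcomp Require Import topology normedtype derive.
From mathcomp Require Import ring lra zify.
Set Implicit Arguments.
Unset Strict Implicit.
Unset Printing Implicit Defensive.
Import Order.TTheory GRing.Theory Num.Theory.
Import numFieldNormedType.Exports.
Local Open Scope classical_set_scope.
Local Open Scope ring_scope.

(** The matrix [X] is congruent to [A], hence positive definite; let [l_i] be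
    its eigenvalues.  Since [B^{-1/2} B^{-1/2} = B^{-1}], one has
    [tau = sum (1 - l_i)], [log (det B / det A) = - sum (log l_i)] and
    [||X - I||_F^2 = sum (l_i - 1)^2], so the first inequality follows by
    summing the scalar bound [ln_le_quadratic] over the spectrum, with the
    constant [m = max (1, ||X||_2)], which dominates every [l_i]
    ([ln_det_le]).

    The second inequality amounts to [max (1, ||X||_2) <= N].  For a positive
    definite matrix the spectral norm is at most the trace
    ([spectral_norm_le_trace]), and [tr X = N - tau]; so [tau >= 0] is all that
    is needed.  Here the sign conditions enter: writing [B^{-1}] as the adjugate
    over the determinant and grouping the entries by their diagonal expresses
    [tau] as [(det B)^{-1} sum_k (-1)^k (b_k - a_k) S_k(B)]
    ([tr_invmx_mul_toeplitz]), a sum of nonnegative terms.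

    Both the eigenvalues and the existence of [B^{1/2}] ([sqrtmxP]) come from
    writing a real symmetric matrix as [P^{-1} D P] with [D] diagonal and [P]
    invertible but not necessarily orthogonal ([symmetricmx_diag]); symmetry
    of functions of the matrix is recovered by [symmetricmx_conj_diag]. *)

(** * A quadratic upper bound for the logarithm *)

(** The difference [g] of the two sides has derivative
    [(t - 1) (1/t - 1/m)], which on [(0, m]] has the sign of [t - 1]; hence [g]
    attains its minimum [0] there at [t = 1]. *)
Lemma ln_le_quadratic (R : realType) (m x : R) : 1 <= m -> 0 < x <= m ->
  ln x <= (x - 1) - (x - 1) ^+ 2 / (2 * m).
Proof.
move=> m1 /andP[x0 xm].
have m0 : 0 < m by lra.
pose g := (fun t : R => (t - 1) - (t - 1) ^+ 2 / (2 * m) - ln t).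
pose dg := (fun t : R => (t - 1) * (t^-1 - m^-1)).
have dgE (t : R) : 0 < t -> is_derive t 1 g (dg t).
  move=> t0; have := is_derive1_ln t0 => dln.
  rewrite /g; apply: is_derive_eq.
  rewrite /dg !scaler0 /GRing.scale/=.
  by field; rewrite (gt_eqF m0) (gt_eqF t0).
have gc (u v : R) : 0 < u -> {within `[u, v]%classic, continuous g}.
  move=> u0; apply: derivable_within_continuous => z; rewrite in_itv/= => /andP[uz _].
  by have [] := dgE z (lt_le_trans u0 uz).
have dg1 (t : R) : 1 <= t -> t <= m -> 0 <= dg t.
  by move=> t1 tm; rewrite mulr_ge0 ?subr_ge0// lef_pV2 ?posrE ?(lt_le_trans ltr01 t1).
have dg2 (t : R) : 0 < t -> t <= 1 -> dg t <= 0.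
  move=> t0 t1; rewrite mulr_le0_ge0 ?subr_le0 ?subr_ge0// lef_pV2 ?posrE//.
  exact: le_trans m1.
suff : 0 <= g x - g 1 by rewrite /g ln1; lra.
have dgitv (u v : R) : 0 < u -> forall t, t \in `]u, v[ -> is_derive t 1 g (dg t).
  by move=> u0 t; rewrite in_itv/= => /andP[ut _]; apply/dgE/(lt_trans u0 ut).
have [x1|/ltW x1] := leP x 1.
  have [c] := @MVT_segment R g dg x 1 x1 (dgitv _ _ x0) (gc _ _ x0).
  rewrite in_itv/= => /andP[xc c1] e.
  by rewrite -opprB e oppr_ge0 mulr_le0_ge0 ?subr_ge0// dg2// (lt_le_trans x0).
have [c] := @MVT_segment R g dg 1 x x1 (dgitv _ _ ltr01) (gc _ _ ltr01).
rewrite in_itv/= => /andP[c1 cx] ->.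
by rewrite mulr_ge0 ?subr_ge0// dg1// (le_trans cx).
Qed.

(** * Diagonalization of real symmetric matrices *)

Lemma symmetricmxP (R : fieldType) n (M : 'M[R]_n) :
  reflect (M^T = M) (M \is symmetricmx).
Proof.
apply: (iffP (is_hermitianmxP _ _ _)); rewrite expr0 scale1r map_mx_id//.
Qed.

(** Over [R[i]] the matrix is Hermitian, hence diagonalizable with real
    eigenvalues.  Its minimal polynomial is therefore a product of distinct
    factors [X - r] with [r] real; as minimal polynomials do not change under
    field extension, the real matrix is diagonalizable over [R] already. *)
Lemma symmetricmx_diag (R : rcfType) n (M : 'M[R]_n.+1) : M \is symmetricmx ->
  exists (P : 'M[R]_n.+1) (d : 'rV[R]_n.+1),
    P \in unitmx /\ M = invmx P *m diag_mx d *m P.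
Proof.
move=> /symmetricmxP symM.
pose toC : {rmorphism R -> R[i]} := real_complex R.
pose MC := map_mx toC M.
have MCherm : MC \is hermsymmx.
  apply: realsym_hermsym.
    by apply/symmetricmxP; rewrite /MC map_trmx symM.
  by apply/mxOverP => i j; rewrite mxE; apply/complex_realP; exists (M i j).
have dreal := hermitian_spectral_diag_real MCherm.
have := orthomx_spectralP (hermitian_normalmx MCherm).
set U := spectralmx MC; set d := spectral_diag MC => MCE.
have Uu : U \in unitmx := spectral_unit MC.
pose rs := undup [seq complex.Re (d 0 i) | i <- enum 'I_n.+1].
have minE : mxminpoly MC = \prod_(r <- rs) ('X - (toC r)%:P).
  rewrite MCE -conjVmx// mxminpoly_uconj ?unitmx_inv// mxminpoly_diag.
  have -> : [seq d 0 i | i <- enum 'I_n.+1] =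
      map toC [seq complex.Re (d 0 i) | i <- enum 'I_n.+1].
    rewrite -[RHS]map_comp; apply: eq_map => i /=.
    by rewrite RRe_real//; apply: (mxOverP dreal).
  by rewrite undup_map_inj ?big_map//; exact: complexI.
have [P Pu] : diagonalizable M.
  apply/diagonalizableP; exists rs; first exact: undup_uniq.
  suff -> : mxminpoly M = \prod_(r <- rs) ('X - r%:P) by [].
  apply: (map_poly_inj toC); rewrite -mxminpoly_map minE rmorph_prod/=.
  by apply: eq_bigr => r _; rewrite rmorphB/= map_polyX map_polyC.
move=> /(similar_diagLR Pu)[D ->]; exists P, D; split=> //.
by rewrite conjVmx.
Qed.

(** Symmetry of [P^{-1} E P] means that [E] commutes with [H = P P^T].  For a
    diagonal [D] this says [H_ij = 0] whenever [d_i <> d_j], a condition that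
    passes from [D] to [f(D)]. *)
Lemma symmetricmx_conj_diag (R : fieldType) n (P : 'M[R]_n) (d : 'rV[R]_n) (f : R -> R) :
  P \in unitmx -> invmx P *m diag_mx d *m P \is symmetricmx ->
  invmx P *m diag_mx (map_mx f d) *m P \is symmetricmx.
Proof.
move=> Pu.
have symE (e : 'rV[R]_n) : (invmx P *m diag_mx e *m P)^T = invmx P *m diag_mx e *m P <->
    P *m P^T *m diag_mx e = diag_mx e *m (P *m P^T).
  have PTu : P^T \in unitmx by rewrite unitmx_tr.
  rewrite !trmx_mul tr_diag_mx trmx_inv; split=> [/(congr1 (fun Z => P *m Z *m P^T))|E].
    by rewrite !mulmxA mulmxV// mul1mx -!mulmxA mulVmx// mulmx1 !mulmxA.
  transitivity (invmx P *m (P *m P^T *m diag_mx e) *m invmx P^T).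
    by rewrite !mulmxA mulVmx// mul1mx.
  by rewrite E !mulmxA mulmxK.
move=> /symmetricmxP/symE/matrixP H; apply/symmetricmxP/symE/matrixP => i j.
have := H i j; rewrite !mul_diag_mx !mul_mx_diag !mxE mulrC => /eqP.
rewrite -subr_eq0 -mulrBl mulf_eq0 subr_eq0 mulrC => /orP[/eqP ->//|/eqP ->].
by rewrite !mulr0.
Qed.

(** * Frobenius and spectral norms *)

(** Lagrange's identity: the double sum of [(a_i b_j - a_j b_i)^2] is twice the
    difference of the two sides. *)
Lemma sum_cauchy_schwarz (R : realDomainType) (I : finType) (a b : I -> R) :
  (\sum_i a i * b i) ^+ 2 <= (\sum_i a i ^+ 2) * (\sum_i b i ^+ 2).
Proof.
have : 0 <= \sum_i \sum_j (a i * b j - a j * b i) ^+ 2.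
  by apply: sumr_ge0 => i _; apply: sumr_ge0 => j _; exact: sqr_ge0.
have -> : \sum_i \sum_j (a i * b j - a j * b i) ^+ 2 =
    (\sum_i a i ^+ 2) * (\sum_i b i ^+ 2) + (\sum_i b i ^+ 2) * (\sum_i a i ^+ 2)
    - 2 * ((\sum_i a i * b i) * (\sum_i a i * b i)).
  rewrite !big_distrlr/= mulr_sumr -big_split/= -sumrB; apply: eq_bigr => i _.
  rewrite mulr_sumr -big_split/= -sumrB; apply: eq_bigr => j _; ring.
by rewrite expr2; lra.
Qed.

Lemma frobenius_norm_ge0 (R : realType) m n (M : 'M[R]_(m, n)) : 0 <= frobenius_norm M.
Proof. exact: sqrtr_ge0. Qed.

Lemma frobenius_norm_sqr (R : realType) m n (M : 'M[R]_(m, n)) :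
  frobenius_norm M ^+ 2 = \sum_i \sum_j M i j ^+ 2.
Proof.
by rewrite sqr_sqrtr//; apply: sumr_ge0 => i _; apply: sumr_ge0 => j _; exact: sqr_ge0.
Qed.

Lemma frobenius_norm_sqr_tr (R : realType) m n (M : 'M[R]_(m, n)) :
  frobenius_norm M ^+ 2 = \tr (M^T *m M).
Proof.
rewrite frobenius_norm_sqr exchange_big/=; apply: eq_bigr => j _.
by rewrite mxE; apply: eq_bigr => i _; rewrite mxE expr2.
Qed.

Lemma frobenius_norm_eq0 (R : realType) m n (M : 'M[R]_(m, n)) :
  (frobenius_norm M == 0) = (M == 0).
Proof.
apply/idP/eqP => [|->]; last first.
  rewrite -sqrf_eq0 frobenius_norm_sqr big1// => i _.
  by rewrite big1// => j _; rewrite mxE expr0n.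
rewrite -sqrf_eq0 frobenius_norm_sqr psumr_eq0 => [/allP H|i _]; last first.
  by apply: sumr_ge0 => j _; exact: sqr_ge0.
apply/matrixP => i j; have /eqP := H i (mem_index_enum _).
move=> /eqP; rewrite psumr_eq0 => [/allP /(_ j (mem_index_enum _))|k _]; last exact: sqr_ge0.
by rewrite sqrf_eq0 mxE => /eqP.
Qed.

Lemma frobenius_normZ (R : realType) m n (c : R) (M : 'M[R]_(m, n)) :
  frobenius_norm (c *: M) = `|c| * frobenius_norm M.
Proof.
apply/eqP; rewrite -(@eqrXn2 _ 2)// ?mulr_ge0// ?frobenius_norm_ge0//; apply/eqP.
rewrite exprMn !frobenius_norm_sqr real_normK ?num_real// mulr_sumr.
apply: eq_bigr => i _; rewrite mulr_sumr; apply: eq_bigr => j _.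
by rewrite mxE exprMn.
Qed.

Lemma frobenius_norm_mulmx (R : realType) m n p (M : 'M[R]_(m, n)) (Y : 'M[R]_(n, p)) :
  frobenius_norm (M *m Y) <= frobenius_norm M * frobenius_norm Y.
Proof.
rewrite -(@ler_pXn2r _ 2)// ?nnegrE ?mulr_ge0 ?frobenius_norm_ge0//.
rewrite exprMn !frobenius_norm_sqr [X in _ * X]exchange_big big_distrlr/=.
apply: ler_sum => i _; apply: ler_sum => k _.
by rewrite mxE; exact: sum_cauchy_schwarz.
Qed.

Lemma frobenius_norm_mulmx_ubound (R : realType) m n (M : 'M[R]_(m, n)) :
  ubound [set frobenius_norm (M *m x) |
    x in [set x : 'cV[R]_n | frobenius_norm x <= 1]] (frobenius_norm M).
Proof.
move=> _ [x /= x1 <-]; apply: le_trans (frobenius_norm_mulmx M x) _.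
by rewrite ler_piMr ?frobenius_norm_ge0.
Qed.

Lemma spectral_norm_le_frobenius (R : realType) m n (M : 'M[R]_(m, n)) :
  spectral_norm M <= frobenius_norm M.
Proof.
apply: ge_sup; last exact: frobenius_norm_mulmx_ubound.
exists (frobenius_norm (M *m (0 : 'cV[R]_n))), 0 => //=.
by have /eqP -> : frobenius_norm (0 : 'cV[R]_n) == 0 by rewrite frobenius_norm_eq0.
Qed.

Lemma eigenvalue_le_spectral_norm (R : realType) n (M : 'M[R]_n) (c : R) (v : 'cV[R]_n) :
  v != 0 -> M *m v = c *: v -> c <= spectral_norm M.
Proof.
rewrite -frobenius_norm_eq0 => v0 Mv; apply: le_trans (ler_norm c) _.
apply: ub_le_sup; first by exists (frobenius_norm M); exact: frobenius_norm_mulmx_ubound.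
have v1 : frobenius_norm ((frobenius_norm v)^-1 *: v) = 1.
  by rewrite frobenius_normZ ger0_norm ?invr_ge0 ?frobenius_norm_ge0// mulVf.
exists ((frobenius_norm v)^-1 *: v) => /=; first by rewrite v1.
by rewrite -scalemxAr Mv scalerA mulrC -scalerA frobenius_normZ v1 mulr1.
Qed.

(** * Positive-definite matrices *)

Lemma posdef1 (R : realType) n : posdef (1%:M : 'M[R]_n).
Proof.
split=> [|x x0]; first by apply/symmetricmxP; exact: trmx1.
rewrite mulmx1 -trace_mx11 -frobenius_norm_sqr_tr exprn_gt0//.
by rewrite lt_def frobenius_norm_eq0 x0 frobenius_norm_ge0.
Qed.

Lemma posdef_unitmx (R : realType) n (M : 'M[R]_n) : posdef M -> M \in unitmx.
Proof.
move=> [_ Mpos]; rewrite unitmxE unitfE; apply/det0P => -[v v0 vM].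
have := Mpos v^T; rewrite trmxK vM mul0mx mxE ltxx trmx_eq0.
by move=> /(_ v0).
Qed.

Lemma posdef_congr (R : realType) n (M C : 'M[R]_n) : posdef M -> C \in unitmx ->
  posdef (C^T *m M *m C).
Proof.
move=> [/symmetricmxP Msym Mpos] Cu; split.
  by apply/symmetricmxP; rewrite !trmx_mul trmxK Msym mulmxA.
move=> x x0; have := Mpos (C *m x); rewrite trmx_mul !mulmxA; apply.
by apply: contra_neq x0 => /(congr1 (mulmx (invmx C))); rewrite mulKmx// mulmx0.
Qed.

(** The eigenvector is column [i] of [P^{-1}]. *)
Lemma conj_diag_eigenvector (R : realType) n (P : 'M[R]_n) (d : 'rV[R]_n) (i : 'I_n) :
  P \in unitmx -> exists2 v : 'cV[R]_n,
    v != 0 & (invmx P *m diag_mx d *m P) *m v = d 0 i *: v.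
Proof.
move=> Pu; exists (invmx P *m delta_mx i 0).
  apply/eqP => /(congr1 (mulmx P)); rewrite mulKVmx// mulmx0 => /matrixP/(_ i 0).
  by rewrite !mxE !eqxx => /eqP; rewrite oner_eq0.
rewrite mulmxA mulmxK// -mulmxA scalemxAr; congr (_ *m _).
apply/matrixP => j k; rewrite mul_diag_mx !mxE.
by case: eqVneq => [->|_]; rewrite ?mulr0.
Qed.

Lemma posdef_diag (R : realType) n (M : 'M[R]_n.+1) : posdef M ->
  exists (P : 'M[R]_n.+1) (d : 'rV[R]_n.+1), [/\ P \in unitmx,
    M = invmx P *m diag_mx d *m P & forall i, 0 < d 0 i].
Proof.
move=> [Msym Mpos]; have [P [d [Pu ME]]] := symmetricmx_diag Msym.
exists P, d; split=> // i; have [v v0] := conj_diag_eigenvector d i Pu.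
rewrite -ME => Mv; have := Mpos v v0.
have v1 := (posdef1 R n.+1).2 v v0.
rewrite -mulmxA Mv -scalemxAr mxE.
by move: v1; rewrite mulmx1 => v1; rewrite pmulr_lgt0.
Qed.

Lemma det_conj_diag (R : realType) n (P : 'M[R]_n) (d : 'rV[R]_n) : P \in unitmx ->
  \det (invmx P *m diag_mx d *m P) = \prod_i d 0 i.
Proof.
move=> Pu; rewrite !det_mulmx det_inv det_diag mulrAC mulVf ?mul1r//.
by rewrite -unitfE -unitmxE.
Qed.

Lemma mxtrace_conj_diag (R : realType) n (P : 'M[R]_n) (d : 'rV[R]_n) : P \in unitmx ->
  \tr (invmx P *m diag_mx d *m P) = \sum_i d 0 i.
Proof. by move=> Pu; rewrite mxtrace_mulC mulmxA mulmxV// mul1mx mxtrace_diag. Qed.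

Lemma posdef_det_gt0 (R : realType) n (M : 'M[R]_n.+1) : posdef M -> 0 < \det M.
Proof.
move=> /posdef_diag[P [d [Pu -> d0]]].
by rewrite det_conj_diag// prodr_gt0.
Qed.

Lemma mul_conj_diag (R : realType) n (P : 'M[R]_n) (d e : 'rV[R]_n) : P \in unitmx ->
  (invmx P *m diag_mx d *m P) *m (invmx P *m diag_mx e *m P) =
  invmx P *m diag_mx (\row_i (d 0 i * e 0 i)) *m P.
Proof.
move=> Pu; rewrite !mulmxA mulmxK// -[_ *m diag_mx _ *m diag_mx _]mulmxA.
by rewrite mulmx_diag.
Qed.

Lemma frobenius_norm_conj_diag (R : realType) n (P : 'M[R]_n) (d : 'rV[R]_n) :
  P \in unitmx -> invmx P *m diag_mx d *m P \is symmetricmx ->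
  frobenius_norm (invmx P *m diag_mx d *m P) ^+ 2 = \sum_i d 0 i ^+ 2.
Proof.
move=> Pu /symmetricmxP sym; rewrite frobenius_norm_sqr_tr sym mul_conj_diag//.
by rewrite mxtrace_conj_diag//; apply: eq_bigr => i _; rewrite mxE expr2.
Qed.

(** With [M = P^{-1} D P], the root is [C = P^{-1} D^{1/2} P]; it is positive
    definite because [C = Q Q] where [Q = P^{-1} D^{1/4} P] is symmetric and
    invertible. *)
Lemma sqrtmxP (R : realType) n (M : 'M[R]_n.+1) : posdef M ->
  posdef (sqrtmx M) /\ sqrtmx M *m sqrtmx M = M.
Proof.
move=> Mpos; apply: (@xgetPex _ 0 [set C | posdef C /\ C *m C = M]).
have [P [d [Pu ME d0]]] := posdef_diag Mpos.
pose F (f : R -> R) := invmx P *m diag_mx (map_mx f d) *m P.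
have FM f g : F f *m F g = F (fun x => f x * g x).
  by rewrite /F mul_conj_diag//; congr (_ *m diag_mx _ *m _); apply/rowP => i; rewrite !mxE.
have QC : F (fun x => Num.sqrt (Num.sqrt x)) *m F (fun x => Num.sqrt (Num.sqrt x)) =
    F Num.sqrt.
  rewrite FM /F; congr (_ *m diag_mx _ *m _); apply/rowP => i.
  by rewrite !mxE -expr2 sqr_sqrtr ?sqrtr_ge0.
have CM : F Num.sqrt *m F Num.sqrt = M.
  rewrite FM ME /F; congr (_ *m diag_mx _ *m _); apply/rowP => i.
  by rewrite !mxE -expr2 sqr_sqrtr ?ltW.
exists (F Num.sqrt); split=> //; rewrite -QC.
set Q := F _ in QC *.
have Qsym : Q^T = Q.
  by apply/symmetricmxP/symmetricmx_conj_diag; rewrite -?ME; case: Mpos.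
have Qu : Q \in unitmx.
  by have := posdef_unitmx Mpos; rewrite -CM -QC !unitmx_mul => /andP[/andP[]].
by have := posdef_congr (posdef1 _ _) Qu; rewrite Qsym mulmx1.
Qed.

(** * Trace of the inverse against a Toeplitz matrix *)

Lemma toeplitz_sym (R : realType) n (b : int -> R) (r s : 'I_n.+1) :
  (forall j : nat, (j <= n)%N -> b (- j%:Z) = b j%:Z) ->
  toeplitz n b r s = b `|r%:Z - s%:Z|%N.
Proof.
move=> hb; rewrite mxE.
have : (`|r%:Z - s%:Z| <= n)%N by have := ltn_ord r; have := ltn_ord s; lia.
by case: (r%:Z - s%:Z) => [//|k] kn; rewrite NegzE hb.
Qed.

(** The entries of the adjugate are the minors of [B] with sign [(-1)^(r+s)],
    which is [(-1)^k] along the two diagonals [|r - s| = k], where the Toeplitz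
    matrix is constant. *)
Lemma tr_invmx_mul_toeplitz (R : realType) n (B : 'M[R]_n.+1) (c : int -> R) :
  B \in unitmx -> (forall j : nat, (j <= n)%N -> c (- j%:Z) = c j%:Z) ->
  \tr (invmx B *m toeplitz n c) =
  (\det B)^-1 * \sum_(k < n.+1) (-1) ^+ k * c k%:Z * minor_sum B k.
Proof.
move=> Bu hc; rewrite /invmx Bu -scalemxAl mxtraceZ; congr (_ * _).
under [RHS]eq_bigr do rewrite mulr_sumr.
rewrite [RHS]exchange_big mxtrace_mulC; apply: eq_bigr => r _ /=.
have dist_lt (s : 'I_n.+1) : (`|r%:Z - s%:Z| < n.+1)%N.
  by have := ltn_ord r; have := ltn_ord s; lia.
rewrite mxE (partition_big (fun s => Ordinal (dist_lt s)) predT)//=.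
apply: eq_bigr => k _; rewrite mulr_sumr; apply: eq_big => [s|s /eqP <-//].
  by rewrite -val_eqE.
rewrite toeplitz_sym// mxE /cofactor /=.
have -> : (-1) ^+ (r + s) = (-1) ^+ `|r%:Z - s%:Z|%N :> R.
  by rewrite -signr_odd -[RHS]signr_odd; congr (_ ^+ nat_of_bool _); lia.
by ring.
Qed.

(** * Spectral estimates for positive-definite matrices *)

Lemma ln_prod (R : realType) (I : Type) (r : seq I) (F : I -> R) :
  (forall i, 0 < F i) -> ln (\prod_(i <- r) F i) = \sum_(i <- r) ln (F i).
Proof.
move=> F0; elim: r => [|i r IH]; first by rewrite !big_nil ln1.
by rewrite !big_cons lnM ?IH ?posrE ?prodr_gt0.
Qed.

Lemma sum_sqr_le_sqr_sum (R : realDomainType) (I : finType) (F : I -> R) :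
  (forall i, 0 <= F i) -> \sum_i F i ^+ 2 <= (\sum_i F i) ^+ 2.
Proof.
move=> F0; rewrite [leRHS]expr2 mulr_suml; apply: ler_sum => i _.
by rewrite expr2 ler_wpM2l// (bigD1 i)//= lerDl sumr_ge0.
Qed.

(** The Frobenius norm dominates the spectral norm, and
    [sum l_i^2 <= (sum l_i)^2] since the eigenvalues [l_i] are positive. *)
Lemma spectral_norm_le_trace (R : realType) n (X : 'M[R]_n.+1) :
  posdef X -> spectral_norm X <= \tr X.
Proof.
move=> Xpos; apply: le_trans (spectral_norm_le_frobenius X) _.
have [P [d [Pu XE d0]]] := posdef_diag Xpos.
have trX : \tr X = \sum_i d 0 i by rewrite XE mxtrace_conj_diag.
have tr0 : 0 <= \tr X by rewrite trX sumr_ge0// => i _; exact: ltW.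
rewrite -(@ler_pXn2r _ 2)// ?nnegrE ?frobenius_norm_ge0//.
rewrite trX XE frobenius_norm_conj_diag -?XE//; last by case: Xpos.
by apply: sum_sqr_le_sqr_sum => i; exact: ltW.
Qed.

(** Sum of [ln_le_quadratic] over the eigenvalues of [X], all of which are at
    most [max (1, ||X||_2)]. *)
Lemma ln_det_le (R : realType) n (X : 'M[R]_n.+1) : posdef X ->
  ln (\det X) <= \tr (X - 1%:M) -
    frobenius_norm (X - 1%:M) ^+ 2 / (2 * Num.max 1 (spectral_norm X)).
Proof.
move=> Xpos; set m := Num.max _ _.
have [P [d [Pu XE d0]]] := posdef_diag Xpos.
have dm i : d 0 i <= m.
  have [v v0] := conj_diag_eigenvector d i Pu; rewrite -XE.
  by move=> /(eigenvalue_le_spectral_norm v0) dX; rewrite le_max dX orbT.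
have XE1 : X - 1%:M = invmx P *m diag_mx (\row_i (d 0 i - 1)) *m P.
  have -> : diag_mx (\row_i (d 0 i - 1)) = diag_mx d - 1%:M.
    apply/matrixP => i j; rewrite !mxE.
    by case: eqVneq => [->|_]; rewrite ?mulr1n ?mulr0n ?subr0.
  by rewrite mulmxBr mulmxBl mulmx1 mulVmx// -XE.
have X1sym : X - 1%:M \is symmetricmx.
  by apply/symmetricmxP; rewrite linearB/= trmx1; case: Xpos => /symmetricmxP ->.
move: X1sym; rewrite XE1 => X1sym.
rewrite frobenius_norm_conj_diag// mxtrace_conj_diag//.
rewrite XE det_conj_diag// ln_prod// mulr_suml -sumrB.
apply: ler_sum => i _; rewrite mxE; apply: ln_le_quadratic.
  by rewrite le_max lexx.
by rewrite d0 dm.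
Qed.

(** * The logarithmic determinant inequality *)

Theorem mainTheorem6 (R : realType) (n : nat) (hn : (1 <= n)%N)
    (b a : int -> R) (B A : 'M[R]_n.+1)
    (hb : forall j : nat, (j <= n)%N -> b (- j%:Z) = b j%:Z)
    (hB : B = toeplitz n b) (hBpos : posdef B)
    (hS : forall k : nat, (k <= n)%N -> 0 <= minor_sum B k)
    (ha : forall j : nat, (j <= n)%N -> a (- j%:Z) = a j%:Z)
    (hA : A = toeplitz n a) (hApos : posdef A)
    (hab : forall j : nat, (j <= n)%N -> 0 <= (-1) ^+ j * (b j%:Z - a j%:Z)) :
  let N := n.+1 in
  let Bhalf_inv := invmx (sqrtmx B) in
  let X := Bhalf_inv *m A *m Bhalf_inv in
  let tau := \tr (invmx B *m (B - A)) in
  let dev := frobenius_norm (X - 1%:M) ^+ 2 in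
  tau + dev / (2 * Num.max 1 (spectral_norm X)) <= ln (\det B / \det A) /\
  tau + dev / (2 * N%:R) <= tau + dev / (2 * Num.max 1 (spectral_norm X)).
Proof.
move=> N C' X tau dev.
have [Cpos CC] := sqrtmxP hBpos.
have Bu := posdef_unitmx hBpos.
have detB := posdef_det_gt0 hBpos.
have detA := posdef_det_gt0 hApos.
have Cu : sqrtmx B \in unitmx := posdef_unitmx Cpos.
have C'u : C' \in unitmx by rewrite unitmx_inv.
have C'sym : C'^T = C' by rewrite trmx_inv; case: Cpos => /symmetricmxP ->.
have Xpos : posdef X by have := posdef_congr hApos C'u; rewrite C'sym.
have C'C' : C' *m C' = invmx B.
  by rewrite -[LHS](mulmxK Bu) -[X in _ *m X *m _]CC mulmxA mulmxKV// mulVmx// mul1mx.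
have detX : \det X = \det A / \det B.
  by rewrite !det_mulmx mulrAC -det_mulmx C'C' det_inv mulrC.
have trX : \tr X = N%:R - tau.
  rewrite mxtrace_mulC mulmxA C'C' /tau mulmxBr mulVmx// linearB/= mxtrace1.
  by rewrite opprB addrC subrK.
(* The sign conditions make every diagonal contribute nonnegatively. *)
have tau0 : 0 <= tau.
  rewrite /tau; have -> : B - A = toeplitz n (fun z => b z - a z).
    by apply/matrixP => r s; rewrite hB hA !mxE.
  rewrite tr_invmx_mul_toeplitz// => [|j jn]; last by rewrite hb// ha.
  apply: mulr_ge0; first by rewrite invr_ge0 ltW.
  by apply: sumr_ge0 => k _; rewrite mulr_ge0 ?hab ?hS// -ltnS.
have dev0 : 0 <= dev by exact: sqr_ge0.
have maxN : Num.max 1 (spectral_norm X) <= N%:R.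
  rewrite ge_max ler1n/=; apply: le_trans (spectral_norm_le_trace Xpos) _.
  by rewrite trX gerBl.
split.
  have -> : ln (\det B / \det A) = - ln (\det X).
    by rewrite detX -lnV ?invf_div// posrE divr_gt0.
  have := ln_det_le Xpos; rewrite linearB/= mxtrace1 trX -/N -/dev.
  by lra.
have max0 : 0 < Num.max 1 (spectral_norm X) by rewrite lt_max ltr01.
by rewrite lerD2l ler_wpM2l// lef_pV2 ?posrE ?mulr_gt0 ?ltr0n// ler_pM2l.
Qed.
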